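(* For each positive integer $n$, let $$G_n(x)=(x-1)^2+2^{-2^{n+1}},$$ a univariate polynomial. Then: (i) the subtraction-free complexity of $G_n(x)$ is finite and is greater than $2^n$; (ii) the ordinary arithmetic circuit complexity of $G_n(x)$ is $O(1)$ if arbitrary constants are allowed as inputs; (iii) if $1$ is the only input constant allowed, the ordinary arithmetic circuit complexity of $G_n(x)$ is $O(n)$.
   Context: An arithmetic circuit is a directed acyclic network whose gates each perform one binary arithmetic operation (addition, subtraction, multiplication or division); its inputs are the variables and scalars, and it outputs a rational function in the variables. The size of a circuit is its number of gates. The ordinary arithmetic circuit complexity of a rational function is the smallest size of an arithmetic circuit computing it (with the allowed input constants as specified). The subtraction-free complexity of a rational function is the smallest size of a circuit computing it that uses only addition, multiplication and division gates, with the variables and arbitrary positive integer scalars as inputs; it is finite exactly when such a circuit exists. *)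

(* Defs.v *)
From HB Require Import structures.
From mathcomp Require Import all_boot all_order all_algebra.

Set Implicit Arguments.
Unset Strict Implicit.
Unset Printing Implicit Defensive.

Import GRing.Theory.
Local Open Scope ring_scope.

Definition ratfun (F : fieldType) := {fraction {poly F}}.

Inductive operation := OpAdd | OpSub | OpMul | OpDiv.

(* [Gate i] is the output of the i-th gate, counting from 0. *)
Inductive operand (F : fieldType) := Var | Scalar of F | Gate of nat.
Arguments Var {F}.
Arguments Gate {F} i.

Record gate (F : fieldType) :=
  MkGate { gate_op : operation; gate_left : operand F; gate_right : operand F }.

(* The gates are listed in a topological order of the network. The output may
   be any node, including an input, so that inputs have complexity 0. *)
Record circuit (F : fieldType) :=
  MkCircuit { gates : seq (gate F); output : operand F }.

Definition circuit_size (F : fieldType) (c : circuit F) : nat := size (gates c).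

(* Values are partial: [None] arises from a reference to a gate that does not
   come earlier in the list (so that defined circuits are acyclic) and from a
   division by the zero rational function. *)
Definition operand_value (F : fieldType) (vs : seq (ratfun F)) (a : operand F) :
    option (ratfun F) :=
  match a with
  | Var => Some (tofrac 'X)
  | Scalar k => Some (tofrac k%:P)
  | Gate i => onth vs i
  end.

Definition apply_operation (F : fieldType) (op : operation) (u v : ratfun F) :
    option (ratfun F) :=
  match op with
  | OpAdd => Some (u + v)
  | OpSub => Some (u - v)
  | OpMul => Some (u * v)
  | OpDiv => if v == 0 then None else Some (u / v)
  end.

Definition gate_value (F : fieldType) (vs : seq (ratfun F)) (g : gate F) :
    option (ratfun F) :=
  match operand_value vs (gate_left g), operand_value vs (gate_right g) with
  | Some u, Some v => apply_operation (gate_op g) u v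
  | _, _ => None
  end.

Fixpoint gates_values (F : fieldType) (vs : seq (ratfun F))
    (gs : seq (gate F)) : option (seq (ratfun F)) :=
  match gs with
  | [::] => Some vs
  | g :: gs' =>
      match gate_value vs g with
      | Some u => gates_values (rcons vs u) gs'
      | None => None
      end
  end.

Definition circuit_value (F : fieldType) (c : circuit F) : option (ratfun F) :=
  match gates_values [::] (gates c) with
  | Some vs => operand_value vs (output c)
  | None => None
  end.

Definition computes (F : fieldType) (c : circuit F) (f : ratfun F) : Prop :=
  circuit_value c = Some f.

Definition operand_over (F : fieldType) (scal : F -> Prop) (a : operand F) :
    Prop :=
  match a with
  | Scalar k => scal k
  | _ => True
  end.

Fixpoint gates_over (F : fieldType) (ops : operation -> Prop)
    (scal : F -> Prop) (gs : seq (gate F)) : Prop :=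
  match gs with
  | [::] => True
  | g :: gs' =>
      [/\ ops (gate_op g), operand_over scal (gate_left g),
          operand_over scal (gate_right g) & gates_over ops scal gs']
  end.

Definition circuit_over (F : fieldType) (ops : operation -> Prop)
    (scal : F -> Prop) (c : circuit F) : Prop :=
  gates_over ops scal (gates c) /\ operand_over scal (output c).

(* [is_complexity ops scal f s] : s is the smallest size of a circuit computing
   f with operations in [ops] and input constants in [scal]. The complexity is
   finite exactly when such an s exists, and s is then unique. *)
Definition is_complexity (F : fieldType) (ops : operation -> Prop)
    (scal : F -> Prop) (f : ratfun F) (s : nat) : Prop :=
  (exists c : circuit F,
      [/\ circuit_over ops scal c, computes c f & circuit_size c = s]) /\
  (forall c : circuit F,
      circuit_over ops scal c -> computes c f -> (s <= circuit_size c)%N).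

Definition any_operation (op : operation) : Prop := True.
Definition no_subtraction (op : operation) : Prop := op <> OpSub.

Definition any_scalar (F : fieldType) (k : F) : Prop := True.
Definition only_one (F : fieldType) (k : F) : Prop := k = 1.
Definition positive_integer (F : fieldType) (k : F) : Prop :=
  exists2 m : nat, (0 < m)%N & k = m%:R.

Definition is_subtraction_free_complexity (F : fieldType) (f : ratfun F)
    (s : nat) : Prop :=
  is_complexity no_subtraction (@positive_integer F) f s.

Definition is_arithmetic_complexity (F : fieldType) (scal : F -> Prop)
    (f : ratfun F) (s : nat) : Prop :=
  is_complexity any_operation scal f s.

Definition G (F : fieldType) (n : nat) : {poly F} :=
  ('X - 1) ^+ 2 + (2%:R ^- (2 ^ n.+1))%:P.

(* Main.v *)
Require Import Defs.
From HB Require Import structures.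
From mathcomp Require Import all_boot all_order all_algebra.
From mathcomp Require Import ring lra zify.
From Stdlib Require Import Classical.

Set Implicit Arguments.
Unset Strict Implicit.
Unset Printing Implicit Defensive.

Import Order.TTheory GRing.Theory Num.Theory.
Local Open Scope ring_scope.

(* A subtraction-free circuit of size s computes P/Q with P, Q nonzero integer
   polynomials with nonnegative coefficients and of degree at most 2^s, since
   each gate at most doubles the degrees. If P/Q = G_n then the roots
   1 +- 'i / M of G_n, with M = 2^(2^n), are roots of P; the powers r^k with
   k <= M of such a root r have positive real part, so deg P > M and s > 2^n.
   A multiple of G_n with nonnegative coefficients exists because multiplying
   by G_n(-x) replaces the arguments of the roots by their doubles in x^2. *)

(** * Nonzero polynomials with nonnegative coefficients *)

(** For nonnegative coefficients, a positive value at 1 amounts to being nonzero; evaluation at 1 is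
    a ring morphism, so stability under sums and products is immediate. *)
Definition nnegpoly (R : numDomainType) (p : {poly R}) : Prop :=
  (forall i : nat, 0 <= p`_i) /\ 0 < p.[1].

Section NonnegativeCoefficients.
Variable R : numDomainType.
Implicit Types p q : {poly R}.

Lemma nnegpolyD p q : nnegpoly p -> nnegpoly q -> nnegpoly (p + q).
Proof.
move=> [hp p1] [hq q1]; split; last by rewrite hornerD addr_gt0.
by move=> i; rewrite coefD addr_ge0.
Qed.

Lemma nnegpolyM p q : nnegpoly p -> nnegpoly q -> nnegpoly (p * q).
Proof.
move=> [hp p1] [hq q1]; split; last by rewrite hornerM mulr_gt0.
by move=> i; rewrite coefM sumr_ge0 // => j _; rewrite mulr_ge0.
Qed.

Lemma nnegpolyX : nnegpoly ('X : {poly R}).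
Proof. by split=> [i|]; rewrite ?hornerX // coefX ler0n. Qed.

Lemma nnegpolyC (c : R) : 0 < c -> nnegpoly c%:P.
Proof.
move=> c0; split=> [i|]; rewrite ?hornerC // coefC.
by case: eqP => // _; apply: ltW.
Qed.

Lemma nnegpoly1 : nnegpoly (1 : {poly R}).
Proof. exact/nnegpolyC/ltr01. Qed.

Lemma nnegpoly_comp_Xn p n : (0 < n)%N -> nnegpoly p -> nnegpoly (p \Po 'X^n).
Proof.
move=> n0 [hp p1]; split; last by rewrite horner_comp hornerXn expr1n.
by move=> i; rewrite coef_comp_poly_Xn //; case: ifP.
Qed.

Lemma nnegpoly_neq0 p : nnegpoly p -> p != 0.
Proof. by case=> _; apply: contraTneq => ->; rewrite horner0 ltxx. Qed.

Lemma gt0_nnegpoly p :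
  (forall i : nat, 0 <= p`_i) -> p != 0 -> nnegpoly p.
Proof.
move=> pn p0; split=> //.
have ltp : ((size p).-1 < size p)%N by rewrite ltn_predL lt0n size_poly_eq0.
rewrite horner_coef (bigD1 (Ordinal ltp)) //= expr1n mulr1 ltr_wpDr //.
  by apply: sumr_ge0 => i _; rewrite expr1n mulr1.
by rewrite lt_def pn lead_coef_eq0 p0.
Qed.

End NonnegativeCoefficients.

(** * Powers of a root of the quadratic, and the degree bound *)

(* Writing [r ^+ k = a + b * 'i / M] for [r = 1 + 'i / M], the recurrence shows
   that [a] stays positive while [k <= M]. *)
Fixpoint power_coords (R : fieldType) (M : R) (k : nat) : R * R :=
  if k is k'.+1 then
    let: (a, b) := power_coords M k' in (a - b / M ^+ 2, a + b)
  else (1, 0).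

(** Modulo the quadratic, ['X - 1] squares to [- M ^- 2] and so plays the role of ['i / M]:
    divisibility replaces evaluation at a complex root. *)
Lemma dvdp_power_coords (R : fieldType) (M : R) (k : nat) :
  ('X - 1) ^+ 2 + (M ^- 2)%:P %|
     'X^k - ((power_coords M k).1%:P + (power_coords M k).2%:P * ('X - 1)).
Proof.
elim: k => [|k IH] /=; first by rewrite mul0r addr0 subrr dvdp0.
case: (power_coords M k) IH => a b /= IH.
have -> : 'X^(k.+1) - ((a - b / M ^+ 2)%:P + (a + b)%:P * ('X - 1)) =
   'X * ('X^k - (a%:P + b%:P * ('X - 1)))
   + b%:P * (('X - 1) ^+ 2 + (M ^- 2)%:P) :> {poly R}.
  by rewrite exprS; ring.
by rewrite dvdp_add // ?dvdp_mull.
Qed.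

Lemma power_coords_gt0 (R : realFieldType) (M k : nat) :
  (0 < M)%N -> (k <= M)%N -> 0 < (power_coords (M%:R : R) k).1.
Proof.
move=> M0 kM; have M0R : 0 < M%:R ^+ 2 :> R by rewrite exprn_gt0 ?ltr0n.
(* As [a <= 1], [b] grows by at most 1 per step, so [M ^+ 2 * a] loses at most [k] at step [k]. The
   lower bound is positive because [k (k - 1) < M ^+ 2] when [k <= M]. *)
suff H : forall k, (k <= M)%N ->
  [/\ (power_coords (M%:R : R) k).1 <= 1,
      M%:R ^+ 2 - k%:R * (k%:R - 1) <= M%:R ^+ 2 * (power_coords (M%:R : R) k).1,
      0 <= (power_coords (M%:R : R) k).2
    & (power_coords (M%:R : R) k).2 <= k%:R].
  have [_ h _ _] := H k kM.
  rewrite -(pmulr_rgt0 _ M0R); apply: lt_le_trans h.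
  have : k%:R <= M%:R :> R by rewrite ler_nat.
  have : 1 <= M%:R :> R by rewrite ler1n.
  have : 0 <= k%:R :> R by rewrite ler0n.
  nra.
elim=> [|j IH] jM /=; first by rewrite mul0r subr0 mulr1; split.
have := IH (ltnW jM); case: (power_coords _ j) => a b /= [a1 ha b0 bj].
have j0 : 0 <= j%:R :> R by rewrite ler0n.
have jMR : j%:R + 1 <= M%:R :> R by rewrite natr1 ler_nat.
have bM0 : 0 <= b / M%:R ^+ 2 by rewrite divr_ge0 // ltW.
have a0 : 0 <= a.
  rewrite -(pmulr_rge0 _ M0R); apply: le_trans ha. nra.
rewrite -natr1; split; [lra | | lra | lra].
have -> : M%:R ^+ 2 * (a - b / M%:R ^+ 2) = M%:R ^+ 2 * a - b :> R.
  by field; rewrite pnatr_eq0 -lt0n.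
nra.
Qed.

(* The argument of the complex root [1 + 'i / M] is smaller than [1 / M]. *)
Lemma nnegpoly_root_size (R : realFieldType) (p : {poly R}) (M : nat) :
  (0 < M)%N -> nnegpoly p -> ('X - 1) ^+ 2 + (M%:R ^- 2)%:P %| p ->
  (M.+1 < size p)%N.
Proof.
move=> M0 pP dvp; rewrite ltnNge; apply/negP => sp.
pose c := power_coords (M%:R : R).
(* The remainder of [p] modulo the quadratic is [A + B ('X - 1)]. It must vanish, yet [A] is a sum
   of nonnegative terms whose leading one is positive. *)
pose A := \sum_(i < size p) p`_i * (c i).1.
pose B := \sum_(i < size p) p`_i * (c i).2.
have dvr : ('X - 1) ^+ 2 + (M%:R ^- 2)%:P %| A%:P + B%:P * ('X - 1).
  have -> : A%:P + B%:P * ('X - 1) = p - \sum_(i < size p) (p`_i)%:P *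
      ('X^i - ((c i).1%:P + (c i).2%:P * ('X - 1))).
    rewrite -[X in _ = X - _]coefK poly_def -sumrB !raddf_sum mulr_suml -big_split /=.
    by apply: eq_bigr => i _; rewrite -mul_polyC; ring.
  apply: dvdp_sub => //; apply: (big_ind (fun q => _ %| q)) => [||i _].
  - exact: dvdp0.
  - exact: dvdp_add.
  - exact/dvdp_mull/dvdp_power_coords.
have A0 : A%:P + B%:P * ('X - 1) = 0 :> {poly R}.
  apply/eqP; apply: contraTT dvr => nz; apply/negP => /(dvdp_leq nz).
  apply/negP; rewrite -ltnNge.
  have -> : size (('X - 1) ^+ 2 + (M%:R ^- 2)%:P : {poly R}) = 3.
    have s3 : size (('X - 1) ^+ 2 : {poly R}) = 3.
      by rewrite -polyC1 size_exp_XsubC.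
    by rewrite size_polyDl // s3; apply: leq_ltn_trans (size_polyC_leq1 _) _.
  rewrite -polyC1 ltnS (leq_trans (size_polyD _ _)) // geq_max.
  rewrite (leq_trans (size_polyC_leq1 _)) //=.
  by rewrite mul_polyC (leq_trans (size_scale_leq _ _)) // size_XsubC.
have {}A0 : A = 0.
  by move/(congr1 (fun q => q.[1])): A0; rewrite !hornerE subrr mulr0 addr0.
have cpos (i : 'I_(size p)) : 0 < (c i).1.
  by apply: power_coords_gt0 => //; rewrite -ltnS (leq_trans (ltn_ord i)).
have [pn p1] := pP.
have psz : (0 < size p)%N by rewrite lt0n size_poly_eq0 nnegpoly_neq0.
have ltp : ((size p).-1 < size p)%N by rewrite ltn_predL.
have /psumr_eq0P/(_ A0 (Ordinal ltp) isT)/eqP : forall i : 'I_(size p), true ->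
    0 <= p`_i * (c i).1 by move=> i _; rewrite mulr_ge0 // ltW.
by rewrite mulf_eq0 (gt_eqF (cpos _)) orbF lead_coef_eq0 (negPf (nnegpoly_neq0 pP)).
Qed.

(** * A multiple with nonnegative coefficients *)

(* Multiplying by the conjugate [a X^2 + 2 b X + d] doubles the argument of the
   roots; [ad - b^2 >= 2^-m ad] bounds it from below, so that after at most [m]
   doublings the middle coefficient becomes nonnegative. *)
Lemma nnegpoly_multiple (R : realDomainType) (m : nat) (a b d : R) :
  0 < a -> 0 < d -> a * d <= 2 ^+ m * (a * d - b ^+ 2) ->
  exists2 q : {poly R}, nnegpoly q &
    nnegpoly (q * (a%:P * 'X^2 - (2 * b)%:P * 'X + d%:P)).
Proof.
have base (a' b' d' : R) : 0 < a' -> 0 < d' -> b' <= 0 ->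
    nnegpoly (a'%:P * 'X^2 - (2 * b')%:P * 'X + d'%:P).
  move=> a0 d0 b0; split=> [i|]; last by rewrite !hornerE /=; lra.
  rewrite !(coefD, coefN, coefCM, coefXn, coefX, coefC).
  by case: i => [|[|[|i]]] /=; lra.
elim: m a b d => [|m IH] a b d a0 d0 hb.
  exists 1; first exact: nnegpoly1.
  rewrite mul1r; apply: base => //.
  have : b ^+ 2 <= 0 by rewrite expr0 in hb; lra.
  by rewrite le_eqVlt ltNge sqr_ge0 orbF sqrf_eq0 => /eqP->.
have [b0|b0] := leP b 0.
  exists 1; first exact: nnegpoly1.
  by rewrite mul1r; apply: base.
(* Chosen so that [(a X^2 + d)^2 - (2 b X)^2 = a^2 X^4 - 2 b' X^2 + d^2]. *)
pose b' := 2 * b ^+ 2 - a * d.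
have ad0 : 0 < a * d by rewrite mulr_gt0.
have [q qP qqP] : exists2 q : {poly R}, nnegpoly q &
    nnegpoly (q * ((a ^+ 2)%:P * 'X^2 - (2 * b')%:P * 'X + (d ^+ 2)%:P)).
  have a20 : 0 < a ^+ 2 by rewrite exprn_gt0.
  have d20 : 0 < d ^+ 2 by rewrite exprn_gt0.
  have [b'0|b'0] := leP b' 0.
    exists 1; first exact: nnegpoly1.
    by rewrite mul1r; apply: base.
  apply: IH => //.
  (* Since [b' > 0] means [4 b^2 > 2 a d], the relative gap [(a d - b^2) / (a d)] at least doubles,
     which pays for passing from [m.+1] to [m]. *)
  have -> : a ^+ 2 * d ^+ 2 - b' ^+ 2 = 4 * b ^+ 2 * (a * d - b ^+ 2).
    by rewrite /b'; ring.
  have gap : 0 <= 2 ^+ m * (a * d - b ^+ 2) by rewrite exprS in hb; lra.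
  rewrite /b' in b'0; rewrite exprS in hb; nra.
exists ((q \Po 'X^2) * (a%:P * 'X^2 + (2 * b)%:P * 'X + d%:P)).
  apply: nnegpolyM; first exact: nnegpoly_comp_Xn.
  rewrite -[b]opprK mulrN polyCN mulNr; apply: base => //; lra.
move/(@nnegpoly_comp_Xn _ _ 2 isT): qqP; congr (nnegpoly _).
rewrite !(comp_polyM, comp_polyB, comp_polyD, comp_polyC, comp_polyX, rmorphXn) /=.
by rewrite /b'; ring.
Qed.

(** * Assembling circuits *)

Lemma gates_over_cat (F : fieldType) (ops : operation -> Prop)
    (scal : F -> Prop) (gs hs : seq (gate F)) :
  gates_over ops scal gs -> gates_over ops scal hs ->
  gates_over ops scal (gs ++ hs).
Proof. by elim: gs => [|g gs IH] //= [? ? ? hgs] hhs; split=> //; apply: IH. Qed.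

Lemma gates_values_cat (F : fieldType) (vs : seq (ratfun F))
    (gs hs : seq (gate F)) :
  gates_values vs (gs ++ hs) =
  if gates_values vs gs is Some ws then gates_values ws hs else None.
Proof. by elim: gs vs => [|g gs IH] vs //=; case: gate_value. Qed.

Lemma operand_value_cat (F : fieldType) (vs ws : seq (ratfun F))
    (a : operand F) (u : ratfun F) :
  operand_value vs a = Some u -> operand_value (vs ++ ws) a = Some u.
Proof.
case: a => //= i vi; rewrite onth_cat ifT //.
by rewrite -onthTE vi.
Qed.

(* Quantifying over the values [vs] already available lets constructions be
   chained without renumbering gates. *)
Definition constructible (F : fieldType) (ops : operation -> Prop)
    (scal : F -> Prop) (k : nat) (f : ratfun F) : Prop :=
  forall vs : seq (ratfun F), exists gs ws a,
    [/\ gates_over ops scal gs, gates_values vs gs = Some (vs ++ ws),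
        operand_over scal a, operand_value (vs ++ ws) a = Some f
      & (size gs <= k)%N].

Section Constructible.
Variables (F : fieldType) (ops : operation -> Prop) (scal : F -> Prop).
Implicit Types f g h : ratfun F.

Lemma constructible_var : constructible ops scal 0 (tofrac 'X).
Proof. by move=> vs; exists [::], [::], Var; split; rewrite ?cats0. Qed.

Lemma constructible_scalar (c : F) :
  scal c -> constructible ops scal 0 (tofrac c%:P).
Proof. by move=> hc vs; exists [::], [::], (Scalar c); split; rewrite ?cats0. Qed.

Lemma constructible_op (op : operation) (k l : nat) f g h :
  ops op -> apply_operation op f g = Some h ->
  constructible ops scal k f -> constructible ops scal l g ->
  constructible ops scal (k + l).+1 h.
Proof.
move=> hop hfg cf cg vs.
have [gs [ws [a [ogs vgs oa va sgs]]]] := cf vs.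
have [hs [xs [b [ohs vhs ob vb shs]]]] := cg (vs ++ ws).
exists (gs ++ hs ++ [:: MkGate op a b]), (ws ++ xs ++ [:: h]),
  (Gate (size (vs ++ ws ++ xs))); split.
- by apply: gates_over_cat => //; apply: gates_over_cat.
- rewrite gates_values_cat vgs gates_values_cat vhs /= /gate_value /=.
  by rewrite (operand_value_cat xs va) vb hfg -cats1 !catA.
- by [].
- by rewrite /= !catA onth_cat ltnn subnn.
- by rewrite !size_cat addn1 !addnS ltnS leq_add.
Qed.

(** Both inputs of the new gate share one subcircuit, so a doubling or a squaring costs a single
    gate; [constructible_op] would duplicate the subcircuit. *)
Lemma constructible_self (op : operation) (k : nat) f h :
  ops op -> apply_operation op f f = Some h ->
  constructible ops scal k f -> constructible ops scal k.+1 h.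
Proof.
move=> hop hff cf vs.
have [gs [ws [a [ogs vgs oa va sgs]]]] := cf vs.
exists (gs ++ [:: MkGate op a a]), (ws ++ [:: h]), (Gate (size (vs ++ ws))).
split.
- exact: gates_over_cat.
- by rewrite gates_values_cat vgs /= /gate_value /= va hff -cats1 !catA.
- by [].
- by rewrite /= !catA onth_cat ltnn subnn.
- by rewrite size_cat addn1.
Qed.

Lemma constructible_expr2n (k n : nat) f :
  ops OpMul -> constructible ops scal k f ->
  constructible ops scal (n + k) (f ^+ (2 ^ n)).
Proof.
move=> hop cf; elim: n => [|n IH]; first by rewrite expr1.
by rewrite expnSr exprM addSn; apply: (constructible_self (op := OpMul)) IH.
Qed.

Lemma constructible_complexity (k : nat) f :
  constructible ops scal k f ->
  exists s, is_complexity ops scal f s /\ (s <= k)%N.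
Proof.
move=> /(_ [::])[gs [ws [a [ogs vgs oa va sgs]]]].
pose P s := exists c : circuit F,
  [/\ circuit_over ops scal c, computes c f & circuit_size c = s].
suff [s [Ps lesk mins]] : exists s,
    [/\ P s, (s <= k)%N & forall t, P t -> (s <= t)%N].
  by exists s; split=> //; split=> // c oc fc; apply: mins; exists c.
have : exists2 s, P s & (s <= k)%N.
  exists (size gs) => //; exists (MkCircuit gs a); split=> //.
  by rewrite /computes /circuit_value /= vgs.
(* Descent to a least size; excluded middle decides whether a smaller circuit exists. *)
case=> s; elim/ltn_ind: s => s IH Ps lesk.
have [[t Pt lt_ts]|nolt] := classic (exists2 t, P t & (t < s)%N).
  exact: (IH t lt_ts Pt (leq_trans (ltnW lt_ts) lesk)).
exists s; split=> // t Pt; rewrite leqNgt; apply/negP => lt_ts.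
by apply: nolt; exists t.
Qed.

End Constructible.

(** * Integer form of the polynomial *)

(** [F] carries no order, so signs are handled over [int]. Clearing the denominator of [G] lets
    identities pass from [F] to [int], and from there to [rat]. *)
Definition intG (n : nat) : {poly int} :=
  (2 ^+ (2 ^ n.+1))%:P * ('X - 1) ^+ 2 + 1.

Lemma map_intG (R : fieldType) (n : nat) : 2 != 0 :> R ->
  map_poly intr (intG n) = (2 ^+ (2 ^ n.+1))%:P * G R n.
Proof.
move=> nz2; have h : 2 ^+ (2 ^ n.+1) != 0 :> R by rewrite expf_neq0.
rewrite /intG rmorphD rmorphM /= map_polyC /= !rmorphXn /= rmorphB /= map_polyX.
by rewrite !rmorph1 /G mulrDr -!polyC_exp -[X in _ = _ + X]polyCM divff.
Qed.

Section CharacteristicZero.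
Variables (F : fieldType) (charF0 : [pchar F] =i pred0).

Let frac (p : {poly int}) : ratfun F := tofrac (map_poly intr p).

Let natrF_eq0 (n : nat) : (n%:R == 0 :> F) = (n == 0%N).
Proof. by move/pcharf0P: charF0. Qed.

Lemma intr_inj_char0 : injective (intr : int -> F).
Proof.
apply: raddf_inj => -[] n /eqP /=.
  by rewrite -pmulrn natrF_eq0 => /eqP ->.
by rewrite NegzE mulrNz oppr_eq0 -pmulrn natrF_eq0.
Qed.

Lemma frac_neq0 (p : {poly int}) : nnegpoly p -> frac p != 0.
Proof.
move=> /nnegpoly_neq0; rewrite tofrac_eq0; apply: contra_neq => /eqP.
by rewrite -(rmorph0 (map_poly intr)) => /eqP /(map_inj_poly intr_inj_char0) ->.
Qed.

(** * Degrees along a subtraction-free circuit *)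

Definition nneg_ratio (d : nat) (u : ratfun F) : Prop :=
  exists p q : {poly int},
    [/\ nnegpoly p, nnegpoly q, (size p <= d.+1)%N, (size q <= d.+1)%N
      & u = frac p / frac q].

Lemma nneg_ratio_operand (vs : seq (ratfun F)) (d : nat) (a : operand F)
    (u : ratfun F) :
  (0 < d)%N -> (forall i v, onth vs i = Some v -> nneg_ratio d v) ->
  operand_over (@positive_integer F) a -> operand_value vs a = Some u ->
  nneg_ratio d u.
Proof.
move=> d0 hvs; case: a => [_ [<-]|c [m m0 ->] [<-]|i _]; last exact: hvs.
- exists 'X, 1; split; rewrite ?size_polyX ?size_poly1 //.
  + exact: nnegpolyX.
  + exact: nnegpoly1.
  + by rewrite /frac map_polyX !rmorph1 divr1.
- exists (m%:Z)%:P, 1; split; rewrite ?size_poly1 //.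
  + exact: nnegpolyC.
  + exact: nnegpoly1.
  + by rewrite (leq_trans (size_polyC_leq1 _)).
  + by rewrite /frac map_polyC !rmorph1 divr1.
Qed.

(** Fractions are combined by cross-multiplication without cancellation, so each gate at most
    doubles [d]. The induction needs arbitrary [vs] and [d] because both change after every gate. *)
Lemma nneg_ratio_gates (gs : seq (gate F)) (vs ws : seq (ratfun F)) (d : nat) :
  (0 < d)%N -> (forall i v, onth vs i = Some v -> nneg_ratio d v) ->
  gates_over no_subtraction (@positive_integer F) gs ->
  gates_values vs gs = Some ws ->
  forall i v, onth ws i = Some v -> nneg_ratio (2 ^ size gs * d) v.
Proof.
elim: gs vs d => [|g gs IH] vs d d0 hvs /=; first by rewrite mul1n => _ [<-].
case=> opg lg rg ogs; rewrite /gate_value.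
case El: operand_value => [u1|] //; case Er: operand_value => [u2|] //.
have [p1 [q1 [p1P q1P sp1 sq1 e1]]] := nneg_ratio_operand d0 hvs lg El.
have [p2 [q2 [p2P q2P sp2 sq2 e2]]] := nneg_ratio_operand d0 hvs rg Er.
have sizeM (r s : {poly int}) : (size r <= d.+1)%N -> (size s <= d.+1)%N ->
    (size (r * s)%R <= (2 * d).+1)%N.
  by move=> sr ss; apply: leq_trans (size_polyMleq _ _) _; lia.
have hg u : apply_operation (gate_op g) u1 u2 = Some u -> nneg_ratio (2 * d) u.
  case: (gate_op g) opg => //= _.
  - case=> <-; exists (p1 * q2 + p2 * q1), (q1 * q2); split.
    + by apply: nnegpolyD; apply: nnegpolyM.
    + exact: nnegpolyM.
    + by rewrite (leq_trans (size_polyD _ _)) // geq_max !sizeM.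
    + exact: sizeM.
    + by rewrite e1 e2 addf_div ?frac_neq0 // /frac !rmorphD !rmorphM.
  - case=> <-; exists (p1 * p2), (q1 * q2); split; try exact: sizeM;
      try exact: nnegpolyM.
    by rewrite e1 e2 mulf_div /frac !rmorphM.
  - case: eqP => // _ [<-].
    exists (p1 * q2), (q1 * p2); split; try exact: sizeM; try exact: nnegpolyM.
    by rewrite e1 e2 invf_div mulf_div /frac !rmorphM.
case Eg: apply_operation => [u|] // gsv; rewrite expnSr -mulnA.
apply: IH (gsv) => //; first by rewrite muln_gt0.
move=> i v; rewrite -cats1 onth_cat; case: ifP => _; last first.
  by case: (i - _)%N => [[<-]|[]] //; apply: hg.
case/hvs => p [q [pP qP sp sq ev]].
by exists p, q; split=> //; [move: sp | move: sq]; lia.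
Qed.

Lemma nneg_ratio_circuit (c : circuit F) (f : ratfun F) :
  circuit_over no_subtraction (@positive_integer F) c -> computes c f ->
  nneg_ratio (2 ^ circuit_size c) f.
Proof.
case=> oc oo; rewrite /computes /circuit_value.
case E: gates_values => [ws|] // cf.
apply: nneg_ratio_operand oo cf; first by rewrite expn_gt0.
by rewrite -[X in nneg_ratio X]muln1; apply: nneg_ratio_gates E => // -[].
Qed.

(** * Finiteness of the subtraction-free complexity *)

(** Horner's rule uses only additions and multiplications. *)
Lemma nnegpoly_constructible (p : {poly int}) : nnegpoly p ->
  exists k, constructible no_subtraction (@positive_integer F) k (frac p).
Proof.
have const c : 0 < c ->
    constructible no_subtraction (@positive_integer F) 0 (frac c%:P).
  case: c => // m m0; rewrite /frac map_polyC.
  by apply: constructible_scalar; exists m.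
elim/poly_ind: p => [/nnegpoly_neq0/eqP//|p c IH] [pn p1].
have c0 : 0 <= c by have := pn 0; rewrite -cons_poly_def coef_cons.
have [p0|p0] := eqVneq p 0.
  exists 0; rewrite p0 mul0r add0r; apply: const.
  by move: p1; rewrite p0 mul0r add0r hornerC.
have [|k ck] := IH.
  apply: gt0_nnegpoly => // i.
  by have := pn i.+1; rewrite -cons_poly_def coef_cons.
have cX : constructible no_subtraction (@positive_integer F) (k + 0).+1
    (frac (p * 'X)).
  apply: (@constructible_op _ _ _ OpMul) ck (constructible_var _ _) => //=.
  by rewrite /frac !rmorphM /= map_polyX.
(* A zero coefficient gets no addition gate, as 0 is not an allowed scalar. *)
move: c0; rewrite le_eqVlt => /predU1P[<-|c0].
  by exists (k + 0).+1; rewrite addr0.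
exists ((k + 0).+1 + 0).+1.
by apply: (@constructible_op _ _ _ OpAdd) cX (const c c0) => //=;
  rewrite /frac !rmorphD.
Qed.

Lemma nnegpoly_intG_multiple (n : nat) :
  exists2 q : {poly int}, nnegpoly q & nnegpoly (q * intG n).
Proof.
pose t : int := 2 ^+ (2 ^ n.+1); have t1 : 1 <= t by rewrite exprn_ege1.
(* Here [a = b = t] and [d = t + 1], so [a d - b^2 = t] and the condition reads [t + 1 <= 2 t]. *)
have [|||q qP qhP] := @nnegpoly_multiple _ (2 ^ n.+1).+1 t t (t + 1).
- lia.
- lia.
- by rewrite exprS -/t; nia.
exists q => //; move: qhP; congr (nnegpoly (_ * _)).
by rewrite /intG -/t; ring.
Qed.

Lemma subtraction_free_constructible_G (n : nat) :
  exists k, constructible no_subtraction (@positive_integer F) k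
              (tofrac (G F n)).
Proof.
have [q qP qhP] := nnegpoly_intG_multiple n.
pose t : int := 2 ^+ (2 ^ n.+1).
have tP : nnegpoly t%:P by apply: nnegpolyC; rewrite exprn_gt0.
have [k ck] := nnegpoly_constructible qhP.
have [l cl] := nnegpoly_constructible (nnegpolyM qP tP).
(* The circuit divides [q * intG n] by [q * t], both with nonnegative coefficients. *)
exists (k + l).+1; apply: (constructible_op (op := OpDiv)) ck cl => //=.
have qt0 := frac_neq0 (nnegpolyM qP tP); rewrite (negPf qt0); congr Some.
apply/eqP; rewrite -(inj_eq (mulIf qt0)) divfK // -tofracM; apply/eqP.
have et : t%:~R = 2 ^+ (2 ^ n.+1) :> F by rewrite /t rmorphXn.
by congr tofrac; rewrite !rmorphM /= map_intG ?natrF_eq0 // map_polyC /= et; ring.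
Qed.

(** * The subtraction-free lower bound *)

Lemma subtraction_free_size_gt (n : nat) (c : circuit F) :
  circuit_over no_subtraction (@positive_integer F) c ->
  computes c (tofrac (G F n)) -> (2 ^ n < circuit_size c)%N.
Proof.
move=> oc cG; have [p [q [pP qP sp _ e]]] := nneg_ratio_circuit oc cG.
pose t : int := 2 ^+ (2 ^ n.+1).
have e1 : t%:P * p = q * intG n.
  apply: (map_inj_poly intr_inj_char0) => //; rewrite !rmorphM /= map_intG ?natrF_eq0 //.
  have : G F n * map_poly intr q = map_poly intr p.
    apply/eqP; rewrite -tofrac_eq tofracM e divfK //; exact: frac_neq0.
  have et : t%:~R = 2 ^+ (2 ^ n.+1) :> F by rewrite /t rmorphXn.
  by rewrite map_polyC /= et => <-; ring.
pose M := (2 ^ (2 ^ n))%N; have M0 : (0 < M)%N by rewrite expn_gt0.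
pose pQ : {poly rat} := map_poly intr p.
have pQP : nnegpoly pQ.
  apply: gt0_nnegpoly => [i|].
    by rewrite coef_map /= ler0z; case: pP.
  rewrite -(rmorph0 (map_poly intr)) (inj_eq (map_inj_poly _ _)) //.
    exact: nnegpoly_neq0.
  exact: intr_inj.
have eM : M%:R ^- 2 = 2 ^- (2 ^ n.+1) :> rat.
  by rewrite /M natrX -exprM -expnSr.
have dv : ('X - 1) ^+ 2 + (M%:R ^- 2)%:P %| pQ.
  have nzt : t%:~R != 0 :> rat by rewrite intr_eq0 expf_neq0.
  have et : t%:~R = 2 ^+ (2 ^ n.+1) :> rat by rewrite /t rmorphXn.
  rewrite eM -/(G rat n) -(dvdpZr _ _ nzt) -mul_polyC -map_polyC -rmorphM e1.
  by rewrite rmorphM /= map_intG // mulrA dvdp_mull.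
have := nnegpoly_root_size M0 pQP dv.
rewrite size_map_inj_poly //; last exact: intr_inj.
(* Combining [M.+1 < size p] with the circuit's degree bound gives
   [2 ^ (2 ^ n) < 2 ^ circuit_size c]. *)
by move=> /leq_trans/(_ sp); rewrite ltnS ltn_exp2l.
Qed.

(** * Short circuits with subtraction *)

Lemma constructible_sqr_sub1 (scal : F -> Prop) : scal 1 ->
  constructible any_operation scal 2 (tofrac (('X - 1) ^+ 2)).
Proof.
move=> s1.
have c1 : constructible any_operation scal 1 (tofrac ('X - 1)).
  apply: (constructible_op (op := OpSub)) (constructible_var _ _)
    (constructible_scalar _ s1) => //=.
  by rewrite tofracB.
by apply: (constructible_self (op := OpMul)) c1 => //=; rewrite -tofracM.
Qed.

Lemma constructible_G (scal : F -> Prop) (n k : nat) : scal 1 ->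
  constructible any_operation scal k (tofrac (2 ^- (2 ^ n.+1))%:P) ->
  constructible any_operation scal (2 + k).+1 (tofrac (G F n)).
Proof.
move=> s1 ck.
apply: (constructible_op (op := OpAdd)) (constructible_sqr_sub1 s1) ck => //=.
by rewrite tofracD.
Qed.

(** One gate for [1 + 1], [n.+1] squarings and one division. *)
Lemma constructible_only_one_inv (n : nat) :
  constructible any_operation (@only_one F) (n.+3)
    (tofrac (2 ^- (2 ^ n.+1))%:P).
Proof.
have c1 := constructible_scalar any_operation (erefl : only_one (1 : F)).
have c2 : constructible any_operation (@only_one F) 1 (tofrac 2%:P).
  by apply: (constructible_self (op := OpAdd)) c1 => //=; rewrite -tofracD -polyCD.
have ct := constructible_expr2n n.+1 I c2.
rewrite -[n.+3]/((0 + n.+2).+1) -[n.+2]addn1.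
apply: (constructible_op (op := OpDiv)) c1 ct => //=.
have h : 2 != 0 :> F by rewrite natrF_eq0.
have h2 : tofrac 2%:P ^+ (2 ^ n.+1) != 0 :> ratfun F.
  by rewrite expf_neq0 // tofrac_eq0 polyC_eq0.
rewrite (negPf h2); congr Some; apply/eqP.
rewrite -(inj_eq (mulIf h2)) divfK // -tofracXn -tofracM -polyC_exp -polyCM.
by rewrite mulVf // expf_neq0.
Qed.

End CharacteristicZero.

Theorem proposition8p3 (F : fieldType) (charF0 : [pchar F] =i pred0) :
  [/\ forall n : nat, (0 < n)%N ->
        exists s : nat,
          is_subtraction_free_complexity (tofrac (G F n)) s /\ (2 ^ n < s)%N,
      exists C : nat, forall n : nat, (0 < n)%N ->
        exists s : nat,
          is_arithmetic_complexity (@any_scalar F) (tofrac (G F n)) s /\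
          (s <= C)%N
    & exists C : nat, forall n : nat, (0 < n)%N ->
        exists s : nat,
          is_arithmetic_complexity (@only_one F) (tofrac (G F n)) s /\
          (s <= C * n)%N].
Proof.
split.
- move=> n _; have [k ck] := subtraction_free_constructible_G charF0 n.
  have [s [cs _]] := constructible_complexity ck.
  exists s; split=> //; have [[c [oc cc <-]] _] := cs.
  exact: (subtraction_free_size_gt charF0) oc cc.
- exists 3 => n _; apply: constructible_complexity.
  exact/constructible_G/constructible_scalar.
(* The circuit has at most [n + 6] gates, and [n + 6 <= 7 n] for positive [n]. *)
- exists 7 => n n0.
  have cG : constructible any_operation (@only_one F) _ (tofrac (G F n)) :=
    constructible_G (erefl : only_one 1) (constructible_only_one_inv charF0 n).
  have [s [cs les]] := constructible_complexity cG.
  by exists s; split=> //; apply: leq_trans les _; lia.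
Qed.
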